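(* Let $T$ be a bounded operator on a complex Banach space $X$. If $T$ admits a bounded $\mathcal{B}$-calculus, then $T$ is power-bounded and $T$ satisfies the (dGSF) condition.
   Context: $\mathbb{D}$ is the open unit disc in $\mathbb{C}$. $L(X)$ is the Banach algebra of bounded linear operators on $X$; $T\in L(X)$ is power-bounded if $\sup_{n\ge0}\|T^n\|<\infty$. $\mathcal{B}(\mathbb{D})$ is the Banach algebra (pointwise operations) of all holomorphic functions $f$ on $\mathbb{D}$ such that $\|f\|_{\mathcal{B}_0}:=\int_0^1\sup_{|\theta|\le\pi}|f'(re^{i\theta})|\,dr<\infty$, with the norm $\|f\|_{\mathcal{B}}:=\|f\|_\infty+\|f\|_{\mathcal{B}_0}$, where $\|f\|_\infty:=\sup_{z\in\mathbb{D}}|f(z)|<\infty$. $T$ admits a bounded $\mathcal{B}$-calculus if there is a bounded algebra homomorphism $\mathcal{B}(\mathbb{D})\to L(X)$ mapping the constant function $1$ to the identity operator $I$ and the identity function $z$ to $T$. An operator $T\in L(X)$ with spectral radius at most $1$ satisfies the (dGSF) (discrete Gomilko–Shi–Feng) condition if, for all $x\in X$ and $x^*\in X^*$, $$\sup_{0<r<1}(1-r)\int_{-\pi}^\pi\big|\langle T(I-re^{i\theta}T)^{-2}x,x^*\rangle\big|\,d\theta<\infty .$$ *)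

(* Defs.v *)
From HB Require Import structures.
From mathcomp Require Import all_boot all_order all_algebra.
From mathcomp Require Import complex.
From mathcomp Require Import all_classical all_reals all_analysis.

Set Implicit Arguments.
Unset Strict Implicit.
Unset Printing Implicit Defensive.

Import Order.TTheory GRing.Theory Num.Theory.
Import numFieldNormedType.Exports.

Local Open Scope classical_set_scope.
Local Open Scope ring_scope.
Local Open Scope complex_scope.

(* The norm of a normed module over R[i] takes its values in R[i], on the
   nonnegative real axis; [nrm v] is that value as an element of R. *)
Definition nrm (R : realType) (V : normedModType R[i]) (v : V) : R :=
  complex.Re `|v|.

Definition opnorm (R : realType) (X Y : normedModType R[i]) (A : X -> Y) :
    \bar R :=
  ereal_sup [set (nrm (A x))%:E | x in [set x : X | nrm x <= 1]].

Definition bounded_linear (R : realType) (X Y : normedModType R[i])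
    (A : X -> Y) : Prop :=
  linear A /\ (opnorm A < +oo)%E.

Definition bounded_functional (R : realType) (X : normedModType R[i])
    (phi : X -> R[i]^o) : Prop :=
  bounded_linear phi.

Definition power_bounded (R : realType) (X : normedModType R[i])
    (T : X -> X) : Prop :=
  (ereal_sup (range (fun n : nat => opnorm (iter n T))) < +oo)%E.

Definition is_op_inverse (R : realType) (X : normedModType R[i])
    (A B : X -> X) : Prop :=
  [/\ bounded_linear B, cancel A B & cancel B A].

Definition op_invertible (R : realType) (X : normedModType R[i])
    (A : X -> X) : Prop :=
  exists B : X -> X, is_op_inverse A B.

(* The inverse of A in L(X); the zero operator when A is not invertible. *)
Definition op_inv (R : realType) (X : normedModType R[i])
    (A : X -> X) : X -> X :=
  xget (fun=> 0) [set B | is_op_inverse A B].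

Definition spectrum (R : realType) (X : normedModType R[i])
    (T : X -> X) : set R[i] :=
  [set lam | ~ op_invertible (fun x => lam *: x - T x)].

(* Equal to -oo when the spectrum is empty, i.e. when X is the zero space. *)
Definition spectral_radius (R : realType) (X : normedModType R[i])
    (T : X -> X) : \bar R :=
  ereal_sup [set (nrm (lam : R[i]^o))%:E | lam in spectrum T].

Definition polar (R : realType) (r theta : R) : R[i] :=
  (r * cos theta) +i* (r * sin theta).

Definition one_minus (R : realType) (X : normedModType R[i]) (T : X -> X)
    (z : R[i]) : X -> X :=
  fun x => x - z *: T x.

Definition dGSF (R : realType) (X : normedModType R[i]) (T : X -> X) : Prop :=
  (spectral_radius T <= 1)%E /\
  forall (x : X) (phi : X -> R[i]^o), bounded_functional phi ->
    (ereal_sup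
       [set ((1 - r)%R%:E *
             \int[lebesgue_measure]_(theta in `[(- pi)%R, pi%R])
               (nrm (phi (T (iter 2 (op_inv (one_minus T (polar r theta)))
                              x))))%:E)%E
       | r in `]0%R, 1%R[%classic] < +oo)%E.

Definition unit_disc (R : realType) : set R[i] :=
  [set z | nrm (z : R[i]^o) < 1].

(* Functions are total on R[i]; only their values on the disc matter below.
   Differentiability is over the scalar field R[i], hence complex. *)
Definition holomorphic_on_disc (R : realType) (f : R[i]^o -> R[i]^o) : Prop :=
  forall z : R[i]^o, unit_disc z -> derivable f z 1.

Definition sup_norm (R : realType) (f : R[i]^o -> R[i]^o) : \bar R :=
  ereal_sup [set (nrm (f z))%:E | z in @unit_disc R].

Definition B0_norm (R : realType) (f : R[i]^o -> R[i]^o) : \bar R :=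
  (\int[lebesgue_measure]_(r in `]0%R, 1%R[)
     ereal_sup [set (nrm ('D_1 f (polar r theta : R[i]^o)))%:E
               | theta in [set theta : R | (`|theta| <= pi)%R]])%E.

Definition B_norm (R : realType) (f : R[i]^o -> R[i]^o) : \bar R :=
  (sup_norm f + B0_norm f)%E.

Definition in_B (R : realType) (f : R[i]^o -> R[i]^o) : Prop :=
  holomorphic_on_disc f /\ (B0_norm f < +oo)%E.

(* An element of B(D) is represented by any f satisfying [in_B]; the second
   clause makes [Phi f] depend only on the restriction of f to the disc. *)
Definition is_bounded_B_calculus (R : realType) (X : normedModType R[i])
    (T : X -> X) (Phi : (R[i]^o -> R[i]^o) -> (X -> X)) : Prop :=
  [/\ (forall f, in_B f -> bounded_linear (Phi f)),
      (forall f g, in_B f -> in_B g ->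
         (forall z, unit_disc z -> f z = g z) -> Phi f =1 Phi g),
      [/\ (forall f g, in_B f -> in_B g ->
             Phi (fun z => f z + g z) =1 (fun x => Phi f x + Phi g x)),
          (forall (a : R[i]) f, in_B f ->
             Phi (fun z => a * f z) =1 (fun x => a *: Phi f x)) &
          (forall f g, in_B f -> in_B g ->
             Phi (fun z => f z * g z) =1 (Phi f \o Phi g))],
      (exists M : R, forall f, in_B f ->
         (opnorm (Phi f) <= M%:E * B_norm f)%E) &
      Phi (fun=> 1) =1 idfun /\ Phi (fun z => z) =1 T].

Definition admits_bounded_B_calculus (R : realType) (X : normedModType R[i])
    (T : X -> X) : Prop :=
  exists Phi : (R[i]^o -> R[i]^o) -> (X -> X), is_bounded_B_calculus T Phi.

(* Main.v *)
From HB Require Import structures.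
Require Import Defs.
From mathcomp Require Import all_boot all_order all_algebra.
From mathcomp Require Import complex ring lra.
From mathcomp Require Import all_classical all_reals all_analysis.
From mathcomp Require Import measurable_realfun.

(** Powers of [T] are the values of the calculus at the monomials [z ^+ n], whose
    norm in B(D) is at most [2], which gives power-boundedness.  For [|w| < 1]
    the calculus maps [(1 - w z)^-1] to the inverse of [I - w T], so that the
    spectrum lies in the closed disc and
    [T (I - w T)^-2] is the value at the kernel [q_w z = z (1 - w z)^-2].

    For the integral condition one wants to pull the integral over the circle
    [|w| = r] inside the calculus: if [c] is unimodular with
    [c(w) <T (I - w T)^-2 x, phi>] equal to the modulus of the pairing, then the
    integral of the moduli is [<Phi g x, phi>] with [g] the integral of
    [c(w) q_w].  It then suffices that [g] have norm [O (1 / (1 - r))] in B(D).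
    This is a property of the Poisson kernel.  The average of
    [|1 - w z|^-2] over [|w| = r] is [(1 - r^2 |z|^2)^-1], which bounds [g]
    directly.  The derivative of [q_w] has a triple pole, so the derivative of
    [g] on [|z| = t] is [O ((1 - r t)^-2)], and the integral of that majorant
    over [0 < t < 1] is [(1 - r)^-1].

    Here the integral is replaced by a sum over [N] equidistributed points of
    the circle, which keeps every operator a finite linear combination.  The
    Poisson average over the [N]-th roots of unity is again explicit
    ([sum_inv_1B_unity], [sum_sqr_kernel_le]), which yields the norm bound for
    the discrete [g] ([B_norm_sum_sq_kernel_le]) as soon as [r ^+ N <= 1/2].  The
    resolvent identity makes the pairing Lipschitz in the angle for fixed [r]
    ([calculus_sq_res_lipschitz]); a mesh adapted to that Lipschitz constant
    keeps the integral below the Riemann sum plus an absolute constant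
    ([calculus_dGSF]). *)

Set Implicit Arguments.
Unset Strict Implicit.
Unset Printing Implicit Defensive.

Import Order.TTheory GRing.Theory Num.Theory.
Import numFieldNormedType.Exports.

Local Open Scope classical_set_scope.
Local Open Scope ring_scope.
Local Open Scope complex_scope.

(** * Real-valued norms and moduli of complex numbers *)

Section RealNorm.
Variables (R : realType) (V : normedModType R[i]).
Implicit Types v w : V.

Lemma nrmE v : `|v| = (nrm v)%:C.
Proof. by rewrite /nrm RRe_real // ger0_real. Qed.

Lemma nrm_ge0 v : 0 <= nrm v.
Proof. by rewrite -ler0c -nrmE. Qed.

Lemma nrm0 : nrm (0 : V) = 0.
Proof. by rewrite /nrm normr0. Qed.

Lemma nrm_eq0 v : nrm v = 0 -> v = 0.
Proof. by move=> v0; apply/eqP; rewrite -normr_eq0 nrmE v0. Qed.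

Lemma le_nrmD v w : nrm (v + w) <= nrm v + nrm w.
Proof. by rewrite -lecR rmorphD /= -!nrmE ler_normD. Qed.

Lemma le_nrm_sum (I : Type) (s : seq I) (f : I -> V) :
  nrm (\sum_(i <- s) f i) <= \sum_(i <- s) nrm (f i).
Proof.
elim/big_ind2 : _ => //; first by rewrite nrm0.
by move=> v a w b va wb; rewrite (le_trans (le_nrmD _ _)) // lerD.
Qed.

Lemma nrmZ (a : R[i]) v : nrm (a *: v) = nrm (a : R[i]^o) * nrm v.
Proof. by apply: complexI; rewrite rmorphM /= -!nrmE normrZ. Qed.

End RealNorm.

Section ComplexModulus.
Variable R : realType.
Implicit Types (z w : R[i]) (x : R).
Local Notation abs z := (@nrm R R[i]^o z).

Lemma absE z : `|z| = (abs z)%:C.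
Proof. exact: (@nrmE R R[i]^o). Qed.

Lemma absM z w : abs (z * w) = abs z * abs w.
Proof. exact: (@nrmZ R R[i]^o). Qed.

Lemma abs1 : abs 1 = 1.
Proof. by apply: complexI; rewrite -absE normr1. Qed.

Lemma absX z n : abs (z ^+ n) = abs z ^+ n.
Proof. by apply: complexI; rewrite rmorphXn /= -!absE normrX. Qed.

Lemma absV z : abs z^-1 = (abs z)^-1.
Proof. by apply: complexI; rewrite fmorphV /= -!absE normfV. Qed.

Lemma abs_real x : abs x%:C = `|x|.
Proof.
by apply: complexI; rewrite -absE normc_def /= expr0n addr0 sqrtr_sqr.
Qed.

Lemma abs_nat n : abs n%:R = n%:R.
Proof. by rewrite -(rmorph_nat (real_complex R)) abs_real ger0_norm. Qed.

Lemma abs_eq0 z : (abs z == 0) = (z == 0).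
Proof.
by apply/eqP/eqP => [/nrm_eq0 //|->]; exact: (@nrm0 R R[i]^o).
Qed.

Lemma sqr_abs z : abs z ^+ 2 = complex.Re z ^+ 2 + complex.Im z ^+ 2.
Proof.
by apply: complexI; rewrite rmorphXn /= -absE add_Re2_Im2.
Qed.

Lemma abs_polar (r theta : R) : 0 <= r -> abs (polar r theta) = r.
Proof.
move=> r0; apply/eqP; rewrite -(eqrXn2 (n:=2)) // ?nrm_ge0 // sqr_abs /=.
by rewrite !exprMn -mulrDr cos2Dsin2 mulr1.
Qed.

Lemma Re_le_abs z : complex.Re z <= abs z.
Proof.
rewrite -lecR -absE; apply: le_trans (normc_ge_Re z).
by rewrite lecR ler_norm.
Qed.

Lemma abs_Complex (a b : R) : abs (a +i* b) <= `|a| + `|b|.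
Proof.
rewrite -(ler_pXn2r (n:=2)) ?nnegrE ?nrm_ge0 ?addr_ge0 // sqr_abs /=.
rewrite sqrrD !real_normK ?num_real //.
have : 0 <= `|a| * `|b| by rewrite mulr_ge0.
lra.
Qed.

(** Reverse triangle inequality around [1]: this is what keeps the poles of all
    the kernels below away from the disc. *)
Lemma abs_1B_ge z : 1 - abs z <= abs (1 - z).
Proof.
have := @le_nrmD R R[i]^o (1 - z) z; rewrite subrK abs1; lra.
Qed.

Lemma abs_1D_le z : abs (1 + z) <= 1 + abs z.
Proof. by have := @le_nrmD R R[i]^o 1 z; rewrite abs1. Qed.

Lemma sub1_neq0 z : abs z < 1 -> 1 - z != 0.
Proof.
move=> z1; rewrite -abs_eq0 gt_eqF //.
by apply: lt_le_trans (abs_1B_ge z); rewrite subr_gt0.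
Qed.

Lemma abs_1BV_le z s : abs z <= s -> s < 1 -> abs (1 - z)^-1 <= (1 - s)^-1.
Proof.
move=> zs s1; rewrite absV lef_pV2 ?posrE; last 2 first.
- by apply: lt_le_trans (abs_1B_ge z); lra.
- lra.
by apply: le_trans (abs_1B_ge z); lra.
Qed.

(** The multiplier that rotates [z] onto its modulus; it is [0] at [z = 0], hence
    of modulus at most [1] rather than unimodular. *)
Definition phase z : R[i] := (abs z)%:C / z.

Lemma phaseM z : phase z * z = (abs z)%:C.
Proof.
rewrite /phase; have [->|z0] := eqVneq z 0; last by rewrite divfK.
by rewrite mulr0 (@nrm0 R R[i]^o).
Qed.

Lemma abs_phase z : abs (phase z) <= 1.
Proof.
rewrite absM absV abs_real ger0_norm ?nrm_ge0 //.
by have [->|z0] := eqVneq (abs z) 0; rewrite ?mul0r // divff.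
Qed.

End ComplexModulus.
Local Notation abs z := (@nrm _ _^o z).

(** * The Poisson kernel averaged over roots of unity *)

Section RootsOfUnity.

(** Expanding each summand as a finite geometric series in [om ^+ k * u], whose
    [N]-th power is [u ^+ N], only the exponent [0] survives the sum over the
    [N]-th roots of unity. *)
Lemma sum_inv_1B_unity (F : fieldType) (N : nat) (om u : F) :
  N.-primitive_root om -> u ^+ N != 1 ->
  \sum_(k < N) (1 - om ^+ k * u)^-1 = N%:R / (1 - u ^+ N).
Proof.
move=> omN uN1.
have N0 := prim_order_gt0 omN.
have uN1' : 1 - u ^+ N != 0 by rewrite subr_eq0 eq_sym.
apply: (canRL (mulfK uN1')); rewrite mulr_suml.
have geom (k : 'I_N) :
    (1 - om ^+ k * u)^-1 * (1 - u ^+ N) = \sum_(j < N) (om ^+ j) ^+ k * u ^+ j.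
  have wN : (om ^+ k * u) ^+ N = u ^+ N.
    by rewrite exprMn exprAC (prim_expr_order omN) expr1n mul1r.
  have w1 : 1 - om ^+ k * u != 0.
    apply: contra uN1' => /eqP/subr0_eq/esym w1.
    by rewrite -wN w1 expr1n subrr.
  apply: (mulfI w1); rewrite mulVKf // -wN -[LHS]opprB subrX1 -mulNr opprB.
  by congr (_ * _); apply: eq_bigr => j _; rewrite exprMn exprAC.
rewrite (eq_bigr _ (fun k _ => geom k)) exchange_big /=.
rewrite (bigD1 (Ordinal N0)) //= [X in _ + X]big1 ?addr0 => [|j j0].
  rewrite (eq_bigr (fun=> 1)) => [|k _]; last by rewrite !expr0 expr1n mulr1.
  by rewrite sumr_const card_ord.
rewrite -mulr_suml.
have omj1 : om ^+ j - 1 != 0.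
  rewrite subr_eq0 -(prim_order_dvd omN) gtnNdvd ?ltn_ord // lt0n.
  by apply: contra j0 => /eqP j0; apply/eqP/val_inj.
suff -> : \sum_(k < N) (om ^+ j) ^+ k = 0 by rewrite mul0r.
by apply: (mulfI omj1); rewrite -subrX1 exprAC (prim_expr_order omN) expr1n mulr0 subrr.
Qed.

Variable R : realType.

Lemma polar1D (a b : R) : polar 1 (a + b) = polar 1 a * polar 1 b.
Proof.
apply/eqP; rewrite eq_complex /polar /= !mul1r cosD sinD.
by rewrite eqxx addrC eqxx.
Qed.

Lemma polarE (r a : R) : polar r a = r%:C * polar 1 a.
Proof.
by apply/eqP; rewrite eq_complex /polar /= !mul1r !mul0r subr0 addr0 !eqxx.
Qed.

Lemma polar10 : polar 1 0 = 1 :> R[i].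
Proof. by rewrite /polar cos0 sin0 mulr1 mulr0. Qed.

Lemma polar1X (a : R) n : polar 1 a ^+ n = polar 1 (a *+ n).
Proof.
elim: n => [|n IHn]; first by rewrite polar10.
by rewrite exprSr IHn mulrSr polar1D.
Qed.

Lemma primitive_polar N : (0 < N)%N ->
  N.-primitive_root (polar 1 (2 * pi / N%:R) : R[i]).
Proof.
move=> N0; have N0' : (0 : R) < N%:R by rewrite ltr0n.
have N_neq0 := lt0r_neq0 N0'.
apply/andP; split=> //; apply/forallP => i; apply/eqP.
rewrite unity_rootE polar1X -[_ *+ i.+1]mulr_natr; have := ltn_ord i.
rewrite leq_eqVlt => /predU1P[->|iN].
  rewrite divfK // eqxx /polar !mul1r mulr_natl cos2pi.
  by rewrite sin2pi !eqxx.
rewrite [RHS](ltn_eqF iN); apply/eqP => -[cos1 _].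
pose x : R := pi * (i.+1%:R / N%:R).
have x2 : 2 * pi / N%:R * i.+1%:R = x *+ 2 by rewrite /x; field.
have : 0 < sin x.
  apply: sin_gt0_pi; rewrite /x mulr_gt0 ?pi_gt0 ?divr_gt0 ?ltr0n //=.
  by rewrite gtr_pMr ?pi_gt0 // ltr_pdivrMr // mul1r ltr_nat.
move: cos1; rewrite x2 mul1r cos_mulr2n cos2sin2 => sx0 sx.
have : sin x ^+ 2 = 0 by lra.
by move/eqP; rewrite sqrf_eq0 gt_eqF.
Qed.

(** The Poisson kernel as the real part of a holomorphic function. *)
Lemma poisson_Re (v : R[i]) : v != 1 ->
  (1 - abs v ^+ 2) * abs (1 - v)^-1 ^+ 2 = 2 * complex.Re (1 - v)^-1 - 1.
Proof.
move=> v1; rewrite absV exprVn !sqr_abs; case: v v1 => a b v1 /=.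
have d0 : (1 - a) ^+ 2 + (0 - b) ^+ 2 != 0.
  apply: contra v1; rewrite paddr_eq0 ?sqr_ge0 // !sqrf_eq0 sub0r oppr_eq0.
  rewrite subr_eq0 => /andP[/eqP <- /eqP ->].
  by [].
by rewrite sub0r in d0 *; field.
Qed.

(** Discrete counterpart of [(2 pi)^-1 * \int |1 - s e^(i t)|^-2 = (1 - s^2)^-1]:
    averaging the Poisson kernel of radius [s] over [N] equidistributed points
    gives the Poisson kernel of radius [s ^+ N], bounded once [s ^+ N <= 1/2]. *)
Lemma sum_sqr_kernel_le (N : nat) (om u : R[i]) (s : R) :
  N.-primitive_root om -> abs om = 1 -> abs u = s -> s < 1 ->
  s ^+ N <= 2^-1 ->
  \sum_(k < N) abs (1 - om ^+ k * u)^-1 ^+ 2 <= 4 * N%:R / (1 - s).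
Proof.
move=> omN om1 us s1 sN.
have s0 : 0 <= s by rewrite -us nrm_ge0.
have absw k : abs (om ^+ k * u) = s by rewrite absM absX om1 expr1n mul1r.
have uN : abs (u ^+ N) = s ^+ N by rewrite absX us.
have uN1 : abs (u ^+ N) < 1 by rewrite uN; lra.
have poisson (k : 'I_N) : (1 - s ^+ 2) * abs (1 - om ^+ k * u)^-1 ^+ 2 =
    2 * complex.Re (1 - om ^+ k * u)^-1 - 1.
  rewrite -(absw k) poisson_Re //; apply/eqP => w1.
  by move: s1; rewrite -(absw k) w1 abs1 ltxx.
have sum_poisson : (1 - s ^+ 2) * \sum_(k < N) abs (1 - om ^+ k * u)^-1 ^+ 2 =
    2 * complex.Re (N%:R / (1 - u ^+ N)) - N%:R.
  rewrite mulr_sumr (eq_bigr _ (fun k _ => poisson k)) sumrB sumr_const card_ord.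
  rewrite -mulr_sumr -(sum_inv_1B_unity omN); last first.
    by have := sub1_neq0 uN1; rewrite subr_eq0 eq_sym.
  congr (_ * _ - _).
  by rewrite (big_morph (@complex.Re R) (id1 := 0) (op1 := +%R)) // => -[? ?] [].
have ReN : complex.Re (N%:R / (1 - u ^+ N)) <= N%:R * 2.
  apply: le_trans (Re_le_abs _) _; rewrite absM abs_nat ler_wpM2l //.
  apply: le_trans (abs_1BV_le (s := 2^-1) _ _) _; rewrite ?uN //; first lra.
  by rewrite le_eqVlt; apply/orP; left; apply/eqP; field.
have N0 : (0 : R) <= N%:R by [].
set S := \sum_(k < N) _ in sum_poisson *.
have S0 : 0 <= S by apply: sumr_ge0 => k _; rewrite exprn_ge0 // nrm_ge0.
rewrite ler_pdivlMr ?subr_gt0 // mulrC.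
apply: (@le_trans _ _ ((1 - s ^+ 2) * S)); last by lra.
by rewrite ler_wpM2r // lerB // expr2 ler_piMr //; exact: ltW.
Qed.

End RootsOfUnity.

(** * Upper bounds for integrals *)

Section IntegralBounds.

(** A simple minorant of [f] is one of [g].  Stated for arbitrary functions
    because the circular suprema in [B0_norm] come with no measurability. *)
Lemma ge0_integral_homo d (T : measurableType d) (R : realType)
    (mu : {measure set T -> \bar R}) (D : set T) (f g : T -> \bar R) :
  (forall x, D x -> (0 <= f x)%E) -> (forall x, D x -> (f x <= g x)%E) ->
  (\int[mu]_(x in D) f x <= \int[mu]_(x in D) g x)%E.
Proof.
move=> f0 fg; rewrite !ge0_integralE //; last first.
  by move=> x Dx; apply: le_trans (fg _ Dx); exact: f0.
apply: ereal_sup_le => _ [h /= hf <-]; exists h => // x.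
by apply: le_trans (hf x) _; exact: lee_restrict.
Qed.

Variable R : realType.
Local Notation mu := (@lebesgue_measure R).

Lemma ge0_integral01_le (f : R -> \bar R) (h H : R -> R) :
  (forall x : R, (0 <= x <= 1) -> 0 <= h x) ->
  (forall x : R, (0 <= x <= 1) -> derivable h x 1) ->
  (forall x : R, (0 <= x <= 1) -> is_derive x (1 : R) H (h x)) ->
  (forall x : R, (0 < x < 1) -> (0 <= f x <= (h x)%:E)%E) ->
  (\int[mu]_(x in `]0%R, 1%R[) f x <= (H 1 - H 0)%:E)%E.
Proof.
move=> h0 dh dH fh.
have ch : {within `[0%R, 1%R], continuous h}.
  by apply: derivable_within_continuous => x; rewrite in_itv /=; exact: dh.
have cH (x : R) : (0 <= x <= 1) -> {for x, continuous H}.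
  by move=> /dH [+ _]; move=> /derivable1_diffP/differentiable_continuous.
have <- : (\int[mu]_(x in `[0%R, 1%R]) (h x)%:E)%E = (H 1 - H 0)%:E.
  rewrite (@continuous_FTC2 _ h H) //.
    split=> [x|/=|/=].
    - rewrite in_itv /= => /andP[x0 x1].
      by have [] : is_derive x (1 : R) H (h x) by apply: dH; rewrite !ltW.
    - by apply: cvg_at_right_filter; apply: cH; rewrite lexx ler01.
    - by apply: cvg_at_left_filter; apply: cH; rewrite lexx ler01.
  move=> x; rewrite in_itv /= => /andP[x0 x1]; rewrite derive1E.
  by have [] : is_derive x (1 : R) H (h x) by apply: dH; rewrite !ltW.
apply: (@le_trans _ _ (\int[mu]_(x in `]0%R, 1%R[) (h x)%:E)%E).
  by apply: ge0_integral_homo => x; rewrite /= in_itv /= => /fh /andP[].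
apply: ge0_subset_integral => //.
- by apply/measurable_EFinP; exact: subspace_continuous_measurable_fun.
- by move=> x /=; rewrite !in_itv /= => /andP[? ?]; rewrite !ltW.
Qed.

Lemma itv_split (a delta x : R) (N : nat) :
  (a <= x <= a + N.+1%:R * delta) ->
  exists k : 'I_N.+1,
    (a + k%:R * delta <= x <= a + k.+1%:R * delta)%R.
Proof.
elim: N => [|N IHN] /andP[ax xN].
  by exists ord0; rewrite /= mul0r addr0 ax.
have [xN'|xN'] := leP x (a + N.+1%:R * delta)%R.
  by have [|k xk] := IHN; [rewrite ax|exists (widen_ord (leqnSn _) k)].
by exists ord_max; rewrite /= (ltW xN').
Qed.

Lemma integral_le_riemann_sum (f : R -> R) (N : nat) (a delta : R)
    (b : 'I_N.+1 -> R) :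
  (0 <= delta) -> (forall k, (0 <= b k)%R) -> (forall x, (0 <= f x)%R) ->
  (forall (k : 'I_N.+1) x,
     (a + k%:R * delta <= x <= a + k.+1%:R * delta) -> (f x <= b k)%R) ->
  (\int[mu]_(x in `[a, (a + N.+1%:R * delta)%R]) (f x)%:E <=
    (delta * \sum_(k < N.+1) b k)%R%:E)%E.
Proof.
move=> d0 b0 f0 fb.
pose I (k : 'I_N.+1) := `[(a + k%:R * delta)%R, (a + k.+1%:R * delta)%R]%classic.
pose g k x := ((b k)%:E * (\1_(I k) x)%:E)%E.
have g0 k x : (0 <= g k x)%E by rewrite mule_ge0 ?lee_fin.
have mI k : measurable (I k) by exact: measurable_itv.
have mind (D : set R) k : measurable_fun D (fun x => (\1_(I k) x : R)%:E).
  by apply/measurable_EFinP.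
apply: (@le_trans _ _ (\int[mu]_(x in `[a, (a + N.+1%:R * delta)%R])
    \sum_(k < N.+1) g k x)%E).
  apply: ge0_integral_homo => x; rewrite /= in_itv /= => xa.
    by rewrite lee_fin.
  have [k xk] := itv_split xa.
  rewrite (bigD1 k) //= -[X in (X <= _)%E]adde0 leeD ?sume_ge0 //.
  rewrite /g indicE mem_set ?mule1 ?lee_fin ?fb //.
rewrite ge0_integral_sum //; last by move=> k; apply: measurable_funeM; exact: mind.
rewrite mulr_sumr -sumEFin; apply: lee_sum => k _.
rewrite ge0_integralZl_EFin //; last exact: mind.
rewrite integral_indic; [|exact: measurable_itv|exact: mI].
rewrite [(delta * b k)%R]mulrC EFinM lee_wpmul2l ?lee_fin //.
apply: (@le_trans _ _ (mu (I k))).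
  apply: le_measure; rewrite ?inE; [|exact: mI|exact: subIsetl].
  by apply: measurableI; exact: measurable_itv.
rewrite lebesgue_measure_itv /= lte_fin; case: ifP => _; last by rewrite lee_fin.
by rewrite -EFinB lee_fin -natr1; lra.
Qed.

End IntegralBounds.

(** * Complex derivatives of powers and of resolvent kernels *)

Section Derivatives.
Variable R : realType.
Implicit Types (w z c : R[i]) (f g : R[i]^o -> R[i]^o).

Lemma is_derive_cmul c f z df : is_derive (z : R[i]^o) 1 f df ->
  is_derive (z : R[i]^o) 1 (fun z => c * f z : R[i]^o) (c * df).
Proof. by move=> fz; exact: is_deriveZ. Qed.

Lemma is_derive_mul f g z df dg :
  is_derive (z : R[i]^o) 1 f df -> is_derive (z : R[i]^o) 1 g dg ->
  is_derive (z : R[i]^o) 1 (fun z => f z * g z : R[i]^o) (f z * dg + g z * df).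
Proof. by move=> fz gz; exact: is_deriveM. Qed.

Lemma is_derive_exp n z :
  is_derive (z : R[i]^o) 1 (fun z : R[i]^o => z ^+ n : R[i]^o)
    (n%:R * z ^+ n.-1 : R[i]^o).
Proof.
have expE m : z * (m%:R * z ^+ m.-1) + z ^+ m * 1 = m.+1%:R * z ^+ m.
  case: m => [|m] /=; first by rewrite mul0r mulr0 add0r !mulr1.
  by rewrite mulr1 mulrCA -exprS -[m.+2%:R]natr1 mulrDl mul1r.
elim: n => [|n IHn]; first by rewrite mul0r; exact: is_derive_cst.
have did := is_derive_id (z : R[i]^o) (1 : R[i]^o).
rewrite (_ : (fun z => z ^+ n.+1) = (fun z : R[i]^o => id z * z ^+ n : R[i]^o)).
  exact: is_derive_eq (is_derive_mul did IHn) (expE n).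
by apply/funext => y; exact: (exprS (y : R[i])).
Qed.

Lemma is_derive_fsum N (h : 'I_N -> R[i]^o -> R[i]^o) z (dh : 'I_N -> R[i]^o) :
  (forall k, is_derive (z : R[i]^o) 1 (h k) (dh k)) ->
  is_derive (z : R[i]^o) 1 (fun z => \sum_(k < N) h k z : R[i]^o)
    (\sum_(k < N) dh k).
Proof.
move=> hz; rewrite (_ : (fun z => _) = \sum_(k < N) h k); first exact: is_derive_sum.
by apply/funext => y; rewrite fct_sumE.
Qed.

Definition res_kernel w : R[i]^o -> R[i]^o := fun z => (1 - w * z)^-1.

Lemma is_derive_res_kernel w z : 1 - w * z != 0 ->
  is_derive (z : R[i]^o) 1 (res_kernel w) (w * res_kernel w z ^+ 2).
Proof.
move=> wz0.
have dden : is_derive (z : R[i]^o) 1 (fun z => 1 - w * z : R[i]^o) (- w).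
  have := is_deriveB (is_derive_cst (1 : R[i]^o) (z : R[i]^o) 1)
    (is_derive_cmul w (is_derive_id (z : R[i]^o) 1)).
  by rewrite mulr1 sub0r.
have [den_ex den_val] := dden.
apply: DeriveDef; first exact: (derivableV wz0 den_ex).
rewrite /res_kernel (deriveV wz0 den_ex) den_val.
by rewrite /GRing.scale /= mulrNN exprVn mulrC.
Qed.

Definition sq_kernel w : R[i]^o -> R[i]^o :=
  fun z => z * (res_kernel w z * res_kernel w z).

Lemma is_derive_sq_kernel w z : 1 - w * z != 0 ->
  is_derive (z : R[i]^o) 1 (sq_kernel w)
    ((1 + w * z) * res_kernel w z ^+ 3).
Proof.
move=> wz0; have dres := is_derive_res_kernel wz0.
have did := is_derive_id (z : R[i]^o) (1 : R[i]^o).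
apply: is_derive_eq (is_derive_mul did (is_derive_mul dres dres)) _.
by rewrite /res_kernel; field.
Qed.

End Derivatives.

(** * Estimates of the norm of B(D) *)

Section BesovNorm.
Variable R : realType.
Implicit Types (f g : R[i]^o -> R[i]^o).

Lemma B0_norm_ge0 f : (0 <= B0_norm f)%E.
Proof.
apply: integral_ge0 => r _; apply: ereal_sup_ge.
exists (nrm ('D_1 f (polar r 0 : R[i]^o)))%:E; last by rewrite lee_fin nrm_ge0.
by exists 0 => //=; rewrite normr0 pi_ge0.
Qed.

Lemma B_norm_ge0 f : (0 <= B_norm f)%E.
Proof.
apply: adde_ge0 (B0_norm_ge0 f); apply: ereal_sup_ge.
exists (nrm (f 0))%:E; last by rewrite lee_fin nrm_ge0.
by exists 0 => //; rewrite /unit_disc /= nrm0.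
Qed.

(** The circular suprema in [B0_norm] are rarely computable, so the norm is
    estimated through a radial majorant [h] with a known antiderivative [H]. *)
Lemma in_B_B_norm_le f (f' : R[i] -> R[i]) (S : R) (h H : R -> R) :
  (forall z, unit_disc z -> is_derive (z : R[i]^o) 1 f (f' z)) ->
  (forall z, unit_disc z -> abs (f z) <= S) ->
  (forall z, unit_disc z -> abs (f' z) <= h (abs z)) ->
  (forall x : R, 0 <= x <= 1 -> 0 <= h x) ->
  (forall x : R, 0 <= x <= 1 -> derivable h x 1) ->
  (forall x : R, 0 <= x <= 1 -> is_derive x (1 : R) H (h x)) ->
  in_B f /\ (B_norm f <= (S + (H 1 - H 0))%:E)%E.
Proof.
move=> df fS f'h h0 dh dH.
have B0_le : (B0_norm f <= (H 1 - H 0)%:E)%E.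
  apply: (ge0_integral01_le h0 dh dH) => r /andP[r0 r1]; apply/andP; split.
    apply: ereal_sup_ge.
    exists (nrm ('D_1 f (polar r 0 : R[i]^o)))%:E; last by rewrite lee_fin nrm_ge0.
    by exists 0 => //=; rewrite normr0 pi_ge0.
  apply: ge_ereal_sup => _ [t _ <-]; rewrite lee_fin.
  have abs_rt : abs (polar r t) = r by rewrite abs_polar // ltW.
  have D_rt : unit_disc (polar r t) by rewrite /unit_disc /= abs_rt.
  have [_ ->] := df _ D_rt; rewrite -[in leRHS]abs_rt; exact: f'h.
split.
  split=> [z Dz|]; first by have [] := df z Dz.
  by apply: le_lt_trans B0_le _; rewrite ltry.
rewrite EFinD; apply: leeD => //.
by apply: ge_ereal_sup => _ [z Dz <-]; rewrite lee_fin; exact: fS.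
Qed.

(** A subalgebra of B(D) containing the polynomials and the kernels
    [(1 - w z)^-1] with [|w| < 1], for which stability under sums and products
    is elementary. *)
Definition C1_bounded f := exists (f' : R[i] -> R[i]) (C : R),
  forall z, unit_disc z ->
    [/\ is_derive (z : R[i]^o) 1 f (f' z), abs (f z) <= C & abs (f' z) <= C].

Lemma C1_bounded_in_B f : C1_bounded f -> in_B f.
Proof.
move=> [f' [C fC]].
have C0 : 0 <= C.
  have disc0 : unit_disc (0 : R[i]) by rewrite /unit_disc /= nrm0.
  by have [_ + _] := fC 0 disc0; apply: le_trans; exact: nrm_ge0.
have [] // := @in_B_B_norm_le f f' C (fun=> C) (fun x => C * x).
- by move=> z /fC[].
- by move=> z /fC[].
- by move=> z /fC[].
- by move=> x _; apply: is_derive_eq (is_deriveZ C (is_derive_id x 1)) _; rewrite [LHS]mulr1.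
Qed.

Lemma C1_bounded_cst (c : R[i]) : C1_bounded (fun=> c).
Proof.
exists (fun=> 0), (abs c) => z _; split=> //.
- exact: (is_derive_cst (c : R[i]^o)).
- by rewrite (@nrm0 R R[i]^o) nrm_ge0.
Qed.

Lemma C1_bounded_id : C1_bounded (fun z : R[i]^o => z).
Proof.
exists (fun=> 1), 1 => z /ltW z1; rewrite abs1; split=> //.
exact: (is_derive_id (z : R[i]^o)).
Qed.

Lemma C1_boundedD f g : C1_bounded f -> C1_bounded g ->
  C1_bounded (fun z => f z + g z).
Proof.
move=> [f' [C fC]] [g' [D gD]].
exists (fun z => f' z + g' z), (C + D) => z zD.
have [df fz f'z] := fC z zD; have [dg gz g'z] := gD z zD; split.
- exact: (is_deriveD df dg).
- by apply: le_trans (le_nrmD _ _) _; exact: lerD.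
- by apply: le_trans (@le_nrmD R R[i]^o _ _) _; exact: lerD.
Qed.

Lemma C1_boundedM f g : C1_bounded f -> C1_bounded g ->
  C1_bounded (fun z => f z * g z).
Proof.
move=> [f' [C fC]] [g' [D gD]].
exists (fun z => f z * g' z + g z * f' z), (C * D + D * C) => z zD.
have [df fz f'z] := fC z zD; have [dg gz g'z] := gD z zD.
have a0 (x : R[i]) : 0 <= abs x := nrm_ge0 _.
have C0 := le_trans (a0 _) fz; have D0 := le_trans (a0 _) gz.
split; first exact: is_derive_mul.
- rewrite absM; apply: (@le_trans _ _ (C * D)); last by rewrite lerDl mulr_ge0.
  exact: ler_pM.
- apply: le_trans (@le_nrmD R R[i]^o _ _) _; rewrite !absM.
  by apply: lerD; exact: ler_pM.
Qed.

Lemma C1_bounded_sum N (c : 'I_N -> R[i]) (h : 'I_N -> R[i]^o -> R[i]^o) :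
  (forall k, C1_bounded (h k)) -> C1_bounded (fun z => \sum_(k < N) c k * h k z).
Proof.
elim: N c h => [|N IHN] c h hC.
  under eq_fun do rewrite big_ord0; exact: C1_bounded_cst.
under eq_fun do rewrite big_ord_recr; apply: C1_boundedD; first exact: IHN.
by apply: C1_boundedM => //; exact: C1_bounded_cst.
Qed.

Lemma C1_bounded_exp n : C1_bounded (fun z => z ^+ n).
Proof.
elim: n => [|n IHn]; first exact: C1_bounded_cst.
under eq_fun do rewrite exprS; apply: C1_boundedM => //; exact: C1_bounded_id.
Qed.

Lemma disc_abs_mul_le (w : R[i]) (r : R) (z : R[i]) :
  abs w = r -> unit_disc z -> abs (w * z) <= r.
Proof.
by move=> wr /ltW z1; rewrite absM wr ler_piMr // -wr nrm_ge0.
Qed.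

Lemma C1_bounded_res_kernel (w : R[i]) : abs w < 1 -> C1_bounded (res_kernel w).
Proof.
move=> w1; set K := (1 - abs w)^-1.
have K0 : 0 <= K by rewrite invr_ge0; lra.
exists (fun z => w * res_kernel w z ^+ 2), (K + K ^+ 2) => z zD.
have wz := disc_abs_mul_le (erefl (abs w)) zD.
have kK : abs (res_kernel w z) <= K by exact: abs_1BV_le.
split.
- by apply: is_derive_res_kernel; apply: sub1_neq0; exact: le_lt_trans w1.
- by apply: le_trans kK _; rewrite lerDl exprn_ge0.
- rewrite absM absX; apply: (@le_trans _ _ (K ^+ 2)); last by rewrite lerDr.
  rewrite -[leRHS]mul1r; apply: ler_pM; rewrite ?nrm_ge0 ?exprn_ge0 ?nrm_ge0 //.
    exact: ltW.
  by apply: lerXn2r; rewrite ?nnegrE ?nrm_ge0.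
Qed.

(** The derivative of [z ^+ n] has circular suprema [n * r ^+ n.-1], of
    integral [1] or [0]. *)
Lemma B_norm_exp_le n : (B_norm (fun z : R[i]^o => z ^+ n)%R <= 2%:E)%E.
Proof.
have dX m (x : R) : is_derive x 1 (fun x : R => x ^+ m) (m%:R * x ^+ m.-1).
  have := is_deriveX m (is_derive_id x 1).
  rewrite (_ : id ^+ m = (fun x : R => x ^+ m)); first by rewrite [_ *: _]mulr1.
  by apply/funext => y; rewrite exprfctE.
have [] := @in_B_B_norm_le (fun z => z ^+ n) (fun z => n%:R * z ^+ n.-1) 1
  (fun x => n%:R * x ^+ n.-1) (fun x => x ^+ n).
- by move=> z _; exact: is_derive_exp.
- by move=> z /ltW z1; rewrite absX exprn_ile1 // nrm_ge0.
- by move=> z _; rewrite absM abs_nat absX.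
- by move=> x /andP[x0 _]; rewrite mulr_ge0 // exprn_ge0.
- move=> x _; apply: derivableM; first exact: derivable_cst.
  by have [] := dX n.-1 x.
move=> _ /le_trans; apply; rewrite lee_fin expr1n.
suff : (0 : R) <= 0 ^+ n by lra.
exact: exprn_ge0.
Qed.

(** The majorant [C / (1 - r x) ^+ 2] has the antiderivative
    [C x / (1 - r x)], hence integral [C / (1 - r)]. *)
Lemma B_norm_le_double_pole f (f' : R[i] -> R[i]) (r S C : R) :
  0 <= r < 1 -> 0 <= C ->
  (forall z, unit_disc z -> is_derive (z : R[i]^o) 1 f (f' z)) ->
  (forall z, unit_disc z -> abs (f z) <= S) ->
  (forall z, unit_disc z -> abs (f' z) <= C * (1 - r * abs z)^-1 ^+ 2) ->
  (B_norm f <= (S + C / (1 - r))%:E)%E.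
Proof.
move=> /andP[r0 r1] C0 df fS f'C.
have den0 (x : R) : 0 <= x <= 1 -> 1 - r * x != 0.
  move=> /andP[x0 x1]; rewrite gt_eqF // subr_gt0 (le_lt_trans _ r1) //.
  by rewrite ler_piMr.
have dden (x : R) : is_derive x 1 (fun x : R => 1 - r * x) (- r).
  have := is_deriveB (is_derive_cst (1 : R) x 1)
    (is_deriveZ r (is_derive_id x 1)).
  by rewrite sub0r [r *: _]mulr1.
have dinv (x : R) : 0 <= x <= 1 ->
    is_derive x 1 (fun x : R => (1 - r * x)^-1) (r * (1 - r * x)^-1 ^+ 2).
  move=> x01; have [den_ex den_val] := dden x; pose den (x : R) := 1 - r * x.
  apply: DeriveDef; first exact: (@derivableV R R den x 1 (den0 x x01) den_ex).
  rewrite (@deriveV R R den x 1 (den0 x x01) den_ex) den_val.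
  by rewrite [LHS]mulrNN exprVn mulrC.
have [] := @in_B_B_norm_le f f' S (fun x => C * (1 - r * x)^-1 ^+ 2)
  (fun x => C * (x * (1 - r * x)^-1)) df fS f'C.
- by move=> x _; rewrite mulr_ge0 // sqr_ge0.
- move=> x x01; have [inv_ex _] := dinv x x01.
  apply: derivableM; first exact: derivable_cst.
  exact: (derivableM inv_ex inv_ex).
- move=> x x01.
  have := is_deriveZ C (is_deriveM (is_derive_id x 1) (dinv x x01)).
  move=> /is_derive_eq; apply; rewrite /GRing.scale /=.
  by field; exact: den0.
by move=> _; rewrite !mulr0 !mul0r !mulr1 !mul1r mulr0 subr0.
Qed.

End BesovNorm.

(** * Bounded operators and the calculus *)

Section Operators.
Variables (R : realType) (X Y : normedModType R[i]).
Implicit Types (A B : X -> Y) (c : R).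

(** Turns the bare predicate into a bundled map, to which the generic lemmas on
    linear maps apply. *)
Lemma linear_packed A : linear A -> exists L : {linear X -> Y}, A = L.
Proof.
by move=> lA; exists (HB.pack_for {linear X -> Y} A (GRing.isLinear.Build _ _ _ _ A lA)).
Qed.

Lemma opnorm_bound A c v :
  linear A -> (opnorm A <= c%:E)%E -> nrm (A v) <= c * nrm v.
Proof.
move=> /linear_packed[L ->] Lc.
have [->|v0] := eqVneq v 0; first by rewrite linear0 !nrm0 mulr0.
have nv0 : 0 < nrm v.
  by rewrite lt_def nrm_ge0 andbT; apply: contra v0 => /eqP/nrm_eq0/eqP.
rewrite -ler_pdivrMr //.
have abs_inv : abs ((nrm v)^-1)%:C = (nrm v)^-1.
  by rewrite abs_real ger0_norm // invr_ge0 ltW.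
have := ereal_sup_ubound (S := [set (nrm (L x))%:E | x in [set x : X | nrm x <= 1]]).
move=> /(_ (nrm (L (((nrm v)^-1)%:C *: v)))%:E) L1.
rewrite -lee_fin; apply: le_trans Lc; apply: le_trans (L1 _); last first.
  exists (((nrm v)^-1)%:C *: v) => //=.
  by rewrite nrmZ abs_inv mulVf // gt_eqF.
by rewrite lee_fin linearZ nrmZ abs_inv mulrC.
Qed.

Lemma opnorm_le A c :
  0 <= c -> (forall v, nrm (A v) <= c * nrm v) -> (opnorm A <= c%:E)%E.
Proof.
move=> c0 Ac; apply: ge_ereal_sup => _ [v v1 <-]; rewrite lee_fin.
by apply: le_trans (Ac v) _; rewrite ler_piMr.
Qed.

Lemma bounded_linear_bound A : bounded_linear A ->
  exists2 c, 0 <= c & forall v, nrm (A v) <= c * nrm v.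
Proof.
move=> [lA Aoo].
have A0 : (0 <= opnorm A)%E.
  apply: ereal_sup_ge; exists (nrm (A 0))%:E; last by rewrite lee_fin nrm_ge0.
  by exists 0 => //=; rewrite nrm0.
have Afin : opnorm A \is a fin_num by rewrite ge0_fin_numE.
exists (fine (opnorm A)) => [|v]; first exact: fine_ge0.
by apply: opnorm_bound => //; rewrite fineK.
Qed.

End Operators.

Lemma op_inv_eq (R : realType) (X : normedModType R[i]) (A B : X -> X) :
  is_op_inverse A B -> op_inv A = B.
Proof.
move=> AB; have [_ BA _] := AB.
rewrite /op_inv; case: xgetP => [C _ [_ _ CA]|/(_ B) //].
by apply/funext => x; rewrite -[in RHS](CA x) BA.
Qed.

Section Calculus.
Variables (R : realType) (X : normedModType R[i]) (T : X -> X).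
Variable Phi : (R[i]^o -> R[i]^o) -> X -> X.
Hypothesis hPhi : is_bounded_B_calculus T Phi.

Let in_B1 : in_B (fun=> 1 : R[i]^o).
Proof. by apply: C1_bounded_in_B; exact: C1_bounded_cst. Qed.

Let in_Bid : in_B (fun z : R[i]^o => z).
Proof. by apply: C1_bounded_in_B; exact: C1_bounded_id. Qed.

Lemma calculus_linear f : in_B f -> linear (Phi f).
Proof. by case: hPhi => + _ _ _ _ => /[apply] -[]. Qed.

Lemma calculus_bound : exists2 M : R, 0 <= M &
  forall f (K : R), in_B f -> (B_norm f <= K%:E)%E ->
    forall x, nrm (Phi f x) <= M * K * nrm x.
Proof.
have [_ _ _ [M PhiM] _] := hPhi; exists `|M| => // f K fB fK x.
apply: opnorm_bound; first exact: calculus_linear.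
apply: le_trans (PhiM f fB) _; rewrite EFinM.
apply: (@le_trans _ _ (`|M|%:E * B_norm f)%E).
  by rewrite lee_wpmul2r ?B_norm_ge0 // lee_fin ler_norm.
by rewrite lee_wpmul2l // lee_fin.
Qed.

Lemma calculusM f g x : in_B f -> in_B g ->
  Phi (fun z => f z * g z) x = Phi f (Phi g x).
Proof. by move=> fB gB; have [_ _ [_ _ ->]] := hPhi. Qed.

Lemma calculus_id x : Phi (fun z => z) x = T x.
Proof. by have [_ _ _ _ [_ ->]] := hPhi. Qed.

Lemma calculus1 x : Phi (fun=> 1) x = x.
Proof. by have [_ _ _ _ [-> _]] := hPhi. Qed.

Lemma calculus_exp n x : Phi (fun z => z ^+ n) x = iter n T x.
Proof.
elim: n x => [|n IHn] x; first exact: calculus1.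
have znB : in_B (fun z : R[i]^o => z ^+ n).
  by apply: C1_bounded_in_B; exact: C1_bounded_exp.
have zSn : (fun z : R[i]^o => z ^+ n.+1) = (fun z : R[i]^o => z * z ^+ n).
  by apply/funext => z; exact: (exprS (z : R[i])).
by rewrite zSn; apply: etrans (calculusM x in_Bid znB) _; rewrite calculus_id IHn.
Qed.

Lemma calculus_sum N (c : 'I_N -> R[i]) (h : 'I_N -> R[i]^o -> R[i]^o) x :
  (forall k, C1_bounded (h k)) ->
  Phi (fun z => \sum_(k < N) c k * h k z) x = \sum_(k < N) c k *: Phi (h k) x.
Proof.
have [_ _ [PhiD PhiZ _] _ _] := hPhi.
elim: N c h => [|N IHN] c h hC.
  rewrite big_ord0 -(scale0r (Phi (fun=> 1) x)) -(PhiZ 0 _ in_B1).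
  by congr Phi; apply/funext => z; rewrite big_ord0 mul0r.
rewrite big_ord_recr /= -IHN // -PhiZ; last exact: C1_bounded_in_B.
rewrite -PhiD; first by congr Phi; apply/funext => z; rewrite big_ord_recr.
  by apply: C1_bounded_in_B; exact: C1_bounded_sum.
apply: C1_bounded_in_B; apply: C1_boundedM => //; exact: C1_bounded_cst.
Qed.

Section Resolvent.
Variable w : R[i].
Hypothesis w1 : abs w < 1.

Let kB : in_B (res_kernel w).
Proof. by apply: C1_bounded_in_B; exact: C1_bounded_res_kernel. Qed.

Lemma calculus_res_comm x : Phi (res_kernel w) (T x) = T (Phi (res_kernel w) x).
Proof.
rewrite -!calculus_id.
apply: etrans (esym (calculusM x kB in_Bid)) _.
apply: etrans (calculusM x in_Bid kB); congr Phi.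
by apply/funext => z; exact: (mulrC (res_kernel w z : R[i])).
Qed.

(** The function identity [(1 - w z)^-1 = 1 + w z (1 - w z)^-1] transported to
    operators. *)
Lemma calculus_resE x :
  Phi (res_kernel w) x = x + w *: T (Phi (res_kernel w) x).
Proof.
have [_ Phi_disc [PhiD PhiZ _] _ _] := hPhi.
have zkB : C1_bounded (fun z => z * res_kernel w z).
  by apply: C1_boundedM; [exact: C1_bounded_id|exact: C1_bounded_res_kernel].
have wzkB : C1_bounded (fun z => w * (z * res_kernel w z)).
  by apply: C1_boundedM => //; exact: C1_bounded_cst.
have wzkPhi : Phi (fun z => w * (z * res_kernel w z)) x =
    w *: T (Phi (res_kernel w) x).
  apply: etrans (PhiZ w _ (C1_bounded_in_B zkB) x) _.
  by congr (_ *: _); apply: etrans (calculusM x in_Bid kB) (calculus_id _).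
have sumB : in_B (fun z => 1 + w * (z * res_kernel w z)).
  by apply: C1_bounded_in_B; apply: C1_boundedD => //; exact: C1_bounded_cst.
rewrite -wzkPhi -[X in X + _]calculus1.
apply: etrans (PhiD _ _ in_B1 (C1_bounded_in_B wzkB) x).
apply: Phi_disc kB sumB _ _ => z zD.
have wz0 : 1 - w * z != 0.
  apply: sub1_neq0; apply: le_lt_trans w1; exact: disc_abs_mul_le.
by rewrite /res_kernel; field.
Qed.

Lemma calculus_is_op_inverse : is_op_inverse (one_minus T w) (Phi (res_kernel w)).
Proof.
have [Phi_bl _ _ _ _] := hPhi.
split; first exact: Phi_bl.
- move=> x; rewrite /one_minus.
  have [L LE] := linear_packed (calculus_linear kB).
  have := calculus_resE x; rewrite -calculus_res_comm LE => LxE.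
  by rewrite linearB linearZ /= [X in X - _]LxE addrK.
- by move=> x; rewrite /one_minus [X in X - _]calculus_resE addrK.
Qed.

Lemma op_inv_one_minus : op_inv (one_minus T w) = Phi (res_kernel w).
Proof. exact: op_inv_eq calculus_is_op_inverse. Qed.

Lemma calculus_sq_kernel x : Phi (sq_kernel w) x =
  T (Phi (res_kernel w) (Phi (res_kernel w) x)).
Proof.
have kkB : in_B (fun z => res_kernel w z * res_kernel w z).
  by apply: C1_bounded_in_B; apply: C1_boundedM; exact: C1_bounded_res_kernel.
apply: etrans (calculusM x in_Bid kkB) _.
by rewrite calculus_id; congr T; exact: calculusM.
Qed.

End Resolvent.

Lemma calculus_power_bounded : power_bounded T.
Proof.
have [M M0 PhiM] := calculus_bound.
apply: (@le_lt_trans _ _ (M * 2)%:E); last by rewrite ltry.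
apply: ge_ereal_sup => _ [n _ <-]; apply: opnorm_le; first by rewrite mulr_ge0.
move=> x; rewrite -calculus_exp; apply: PhiM; last exact: B_norm_exp_le.
by apply: C1_bounded_in_B; exact: C1_bounded_exp.
Qed.

Lemma calculus_spectral_radius : (spectral_radius T <= 1)%E.
Proof.
apply: ge_ereal_sup => _ [lam specl <-]; rewrite lee_fin leNgt.
apply/negP => lam1; apply: specl.
have lam0 : lam != 0.
  by apply: contraTneq lam1 => ->; rewrite (@nrm0 R R[i]^o) -leNgt.
have inv1 : abs lam^-1 < 1 by rewrite absV invf_lt1 // (lt_trans _ lam1).
have [[lB Boo] AB BA] := calculus_is_op_inverse inv1.
set B := Phi _ in lB Boo AB BA; have [L LE] := linear_packed lB.
have lamE x : lam *: x - T x = lam *: one_minus T lam^-1 x.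
  by rewrite /one_minus scalerBr scalerA mulfV // scale1r.
exists (fun x => lam^-1 *: B x); split.
- split.
    by move=> a u v; rewrite LE linearP scalerDr !scalerA mulrC.
  have [c c0 Bc] := bounded_linear_bound (conj lB Boo).
  apply: (@le_lt_trans _ _ (abs lam^-1 * c)%:E); last by rewrite ltry.
  apply: opnorm_le => [|v]; first by rewrite mulr_ge0 // nrm_ge0.
  by rewrite nrmZ -mulrA ler_wpM2l // nrm_ge0.
- by move=> x; rewrite lamE LE linearZ /= -LE AB scalerA mulVf // scale1r.
- move=> x; rewrite lamE.
  have -> : one_minus T lam^-1 (lam^-1 *: B x) = lam^-1 *: one_minus T lam^-1 (B x).
    rewrite /one_minus scalerBr.
    have lT : linear T.
      have := calculus_linear in_Bid; rewrite (_ : Phi _ = T) //.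
      by apply/funext => y; exact: calculus_id.
    by have [LT LTE] := linear_packed lT; rewrite LTE (linearZ_LR LT).
  by rewrite BA scalerA mulfV // scale1r.
Qed.

End Calculus.

(** * Weighted sums of kernels, and the choice of nodes *)

Section TestFunctions.
Variable R : realType.

(** The estimate that carries the integral condition.  On the circle of radius
    [t] the derivative of each summand costs a third power of the Cauchy kernel,
    one factor of which is bounded by [(1 - r t)^-1]; averaging the other two
    gives a second factor [(1 - r t)^-1]. *)
Lemma B_norm_sum_sq_kernel_le (N : nat) (om w0 : R[i]) (r : R)
    (c : 'I_N -> R[i]) :
  N.-primitive_root om -> abs om = 1 -> abs w0 = r -> r < 1 ->
  r ^+ N <= 2^-1 -> (forall k, abs (c k) <= 1) ->
  (B_norm (fun z : R[i]^o => \sum_(k < N) c k * sq_kernel (om ^+ k * w0) z)%R <=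
    (12 * N%:R / (1 - r))%:E)%E.
Proof.
move=> omN om1 w0r r1 rN c1.
have r0 : 0 <= r by rewrite -w0r nrm_ge0.
pose w (k : 'I_N) := om ^+ k * w0.
pose u (k : 'I_N) (z : R[i]) : R[i] := res_kernel (w k) z.
have absw k : abs (w k) = r by rewrite absM absX om1 expr1n mul1r.
have wz_lt1 k z : unit_disc z -> abs (w k * z) < 1.
  by move=> zD; apply: le_lt_trans r1; exact: disc_abs_mul_le.
have u_le k z : unit_disc z -> abs (u k z) <= (1 - r * abs z)^-1.
  move=> zD; apply: abs_1BV_le; rewrite -(absw k) -absM //; exact: wz_lt1.
have sum_u z : unit_disc z ->
    \sum_(k < N) abs (u k z) ^+ 2 <= 4 * N%:R / (1 - r * abs z).
  move=> zD; have s_le : r * abs z <= r by rewrite ler_piMr // ltW.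
  have s0 : 0 <= r * abs z by rewrite mulr_ge0 // nrm_ge0.
  rewrite (eq_bigr (fun k : 'I_N => abs (1 - om ^+ k * (w0 * z))^-1 ^+ 2)).
    apply: sum_sqr_kernel_le => //.
    - by rewrite absM w0r.
    - exact: le_lt_trans r1.
    - apply: le_trans rN; exact: lerXn2r.
  by move=> k _; rewrite /u /res_kernel /w mulrA.
pose f' z := \sum_(k < N) c k * ((1 + w k * z) * u k z ^+ 3).
have N0 : (0 : R) <= N%:R by [].
have -> : 12 * N%:R / (1 - r) = 4 * N%:R / (1 - r) + 8 * N%:R / (1 - r).
  by rewrite -!mulrA -mulrDl; congr (_ * _); lra.
apply: (@B_norm_le_double_pole _ _ f'); rewrite ?r0 ?r1 ?mulr_ge0 // => z zD.
- apply: is_derive_fsum => k; apply: is_derive_cmul.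
  by apply: is_derive_sq_kernel; apply: sub1_neq0; exact: wz_lt1.
- apply: le_trans (@le_nrm_sum R R[i]^o _ _ _) _.
  apply: (@le_trans _ _ (4 * N%:R / (1 - r * abs z))).
    apply: le_trans (sum_u z zD); apply: ler_sum => k _.
    rewrite !absM -expr2 mulrA ler_piMl ?sqr_ge0 //.
    by rewrite mulr_ile1 ?nrm_ge0 // ltW.
  rewrite ler_wpM2l ?mulr_ge0 // lef_pV2 ?posrE ?subr_gt0 //.
    by rewrite lerB // ler_piMr // ltW.
  by apply: le_lt_trans r1; rewrite ler_piMr // ltW.
- have s_lt1 : r * abs z < 1 by apply: le_lt_trans r1; rewrite ler_piMr // ltW.
  set K := (1 - r * abs z)^-1; have K0 : 0 <= K by rewrite invr_ge0; lra.
  apply: le_trans (@le_nrm_sum R R[i]^o _ _ _) _.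
  apply: (@le_trans _ _ (\sum_(k < N) 2 * K * abs (u k z) ^+ 2)).
    apply: ler_sum => k _; rewrite absM [abs (_ * _)]absM absX exprS.
    have a0 (v : R[i]) : 0 <= abs v := nrm_ge0 _.
    rewrite -[leRHS]mulrA -[leRHS]mul1r.
    apply: ler_pM => //; first by rewrite !mulr_ge0 // sqr_ge0.
    apply: ler_pM => //; first by rewrite mulr_ge0 // sqr_ge0.
      by apply: le_trans (abs_1D_le _) _; have := wz_lt1 k z zD; lra.
    by rewrite ler_wpM2r ?sqr_ge0 // u_le.
  rewrite -mulr_sumr.
  apply: (@le_trans _ _ (2 * K * (4 * N%:R * K))).
    by rewrite ler_wpM2l ?mulr_ge0 //; exact: sum_u.
  rewrite le_eqVlt; apply/orP; left; apply/eqP; ring.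
Qed.

Lemma lipschitz_cos_sin (a b : R) :
  `|cos a - cos b| <= `|a - b| /\ `|sin a - sin b| <= `|a - b|.
Proof.
have mvt (f df : R -> R) : (forall x, is_derive x (1 : R) f (df x)) ->
    (forall x, `|df x| <= 1) -> `|f a - f b| <= `|a - b|.
  move=> fdf df1; wlog ba : a b / b < a.
    move=> H; have [ab|ba|->] := ltgtP a b; last by rewrite !subrr.
      by rewrite distrC [leRHS]distrC; exact: H.
    exact: H.
  have cf : {within `[b, a], continuous f}.
    by apply: derivable_within_continuous => x _; have [] := fdf x.
  have [c _ ->] := MVT ba (fun x _ => fdf x) cf.
  by rewrite normrM ler_piMl.
split.
  by apply: (mvt _ (fun x => - sin x)) => x; rewrite normrN sin_max.
by apply: (mvt _ cos) => x; rewrite cos_max.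
Qed.

Lemma lipschitz_polar (r a b : R) : 0 <= r <= 1 ->
  abs (polar r a - polar r b) <= 2 * `|a - b|.
Proof.
move=> /andP[r0 r1]; have [cos_ab sin_ab] := lipschitz_cos_sin a b.
have -> : polar r a - polar r b =
    (r * (cos a - cos b)) +i* (r * (sin a - sin b)).
  by apply/eqP; rewrite eq_complex /polar /= !mulrBr !eqxx.
apply: le_trans (abs_Complex _ _) _.
have rx (x : R) : `|r * x| <= `|x| by rewrite normrM ger0_norm // ler_piMl.
have := rx (cos a - cos b); have := rx (sin a - sin b); lra.
Qed.

Lemma exists_fine_mesh (r A : R) : 0 <= r < 1 ->
  exists N : nat, r ^+ N.+1 <= 2^-1 /\ A <= N.+1%:R.
Proof.
move=> /andP[r0 r1].
have rcvg : r ^+ n @[n --> \oo] --> (0 : R) by apply: cvg_expr; rewrite ger0_norm.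
have half : (0 : R) < 2^-1 by [].
have : \forall n \near \oo, r ^+ n <= 2^-1 /\ A <= n.+1%:R.
  near=> n; split.
    by near: n; exact: (cvgr_le _ rcvg _ half).
  near: n; apply: filterS (nbhs_infty_ger A) => n /le_trans; apply.
  by rewrite ler_nat.
move=> /filter_ex[n [rn An]]; exists n; split=> //.
by rewrite exprS; apply: le_trans rn; rewrite ler_piMl ?exprn_ge0 // ltW.
Unshelve. all: by end_near. Qed.

End TestFunctions.

(** * The Gomilko-Shi-Feng condition *)

Section GomilkoShiFeng.
Variables (R : realType) (X : normedModType R[i]) (T : X -> X).
Variable Phi : (R[i]^o -> R[i]^o) -> X -> X.
Hypothesis hPhi : is_bounded_B_calculus T Phi.
Hypothesis hT : bounded_linear T.

Let Res (w : R[i]) := Phi (res_kernel w).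

Lemma calculus_res_bound (r : R) : 0 <= r < 1 ->
  exists2 K : R, 0 <= K &
    forall w x, abs w = r -> nrm (Res w x) <= K * nrm x.
Proof.
move=> r01; have /andP[r0 r1] := r01.
have [M M0 PhiM] := calculus_bound hPhi.
exists (M * ((1 - r)^-1 + r / (1 - r))).
  by rewrite mulr_ge0 // addr_ge0 ?divr_ge0 ?invr_ge0 //; lra.
move=> w x wr; have w1 : abs w < 1 by rewrite wr.
apply: PhiM; first by apply: C1_bounded_in_B; exact: C1_bounded_res_kernel.
have wz z : unit_disc z -> abs (w * z) < 1.
  by move=> zD; apply: le_lt_trans r1; exact: disc_abs_mul_le.
apply: (@B_norm_le_double_pole _ _ (fun z => w * res_kernel w z ^+ 2)) => //.
- by move=> z zD; apply: is_derive_res_kernel; apply: sub1_neq0; exact: wz.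
- by move=> z zD; apply: abs_1BV_le r1; exact: disc_abs_mul_le.
- move=> z zD; rewrite absM wr ler_wpM2l // expr2 absM.
  have kz : abs (res_kernel w z) <= (1 - r * abs z)^-1.
    by apply: abs_1BV_le; rewrite -wr -absM //; exact: wz.
  by rewrite ler_pM // nrm_ge0.
Qed.

(** The resolvent identity makes [w |-> T (I - w T)^-2 x] Lipschitz on each
    circle inside the disc. *)
Lemma calculus_sq_res_lipschitz (r : R) (x : X) : 0 <= r < 1 ->
  exists2 L : R, 0 <= L &
    forall v w, abs v = r -> abs w = r ->
      nrm (T (Res v (Res v x)) - T (Res w (Res w x))) <= L * abs (v - w).
Proof.
move=> r01; have /andP[r0 r1] := r01.
have [K K0 ResK] := calculus_res_bound r01.
have [t t0 Tt] := bounded_linear_bound hT.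
exists (2 * (t * t * K * K * K * nrm x)).
  by rewrite !mulr_ge0 // nrm_ge0.
move=> v w vr wr.
have kB u : abs u = r -> in_B (res_kernel u).
  by move=> ur; apply: C1_bounded_in_B; apply: C1_bounded_res_kernel; rewrite ur.
have [LT LTE] := linear_packed hT.1.
have [Lv LvE] := linear_packed (calculus_linear hPhi (kB v vr)).
have resolvent y : Res v y - Res w y = (v - w) *: Res v (T (Res w y)).
  have v1 : abs v < 1 by rewrite vr.
  have w1 : abs w < 1 by rewrite wr.
  have Rw := calculus_resE hPhi w1 y.
  have Rv := calculus_resE hPhi v1 (Res w y).
  (* Insert [y = (I - w T) (Res w y)] under [Res v]. *)
  have -> : Res v y = Res v (Res w y) - w *: Res v (T (Res w y)).
    rewrite {2}/Res [X in Phi _ X]Rw -/(Res w y) -/(Res v _) /Res LvE.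
    by rewrite linearD linearZ addrK.
  rewrite -(calculus_res_comm hPhi v1) -/(Res v _) in Rv.
  by rewrite scalerBl [X in X - _ - _]Rv addrAC [Res w y + _]addrC addrK.
have diff_le y : nrm (Res v y - Res w y) <= abs (v - w) * (K * (t * (K * nrm y))).
  rewrite resolvent nrmZ ler_wpM2l ?nrm_ge0 //.
  apply: le_trans (ResK _ _ vr) _; rewrite ler_wpM2l //.
  by apply: le_trans (Tt _) _; rewrite ler_wpM2l // ResK.
have -> : T (Res v (Res v x)) - T (Res w (Res w x)) =
    T (Res v (Res v x - Res w x)) + T (Res v (Res w x) - Res w (Res w x)).
  by rewrite LTE /Res LvE !linearB /= addrA subrK.
apply: le_trans (le_nrmD _ _) _.
have -> (a b : R) : 2 * a * b = a * b + a * b by ring.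
apply: lerD.
  apply: (@le_trans _ _ (t * (K * (abs (v - w) * (K * (t * (K * nrm x))))))).
    apply: le_trans (Tt _) _; rewrite ler_wpM2l //.
    by apply: le_trans (ResK _ _ vr) _; rewrite ler_wpM2l.
  by rewrite le_eqVlt; apply/orP; left; apply/eqP; ring.
apply: (@le_trans _ _ (t * (abs (v - w) * (K * (t * (K * (K * nrm x))))))).
  apply: le_trans (Tt _) _; rewrite ler_wpM2l //.
  apply: le_trans (diff_le _) _.
  by rewrite ler_wpM2l ?nrm_ge0 // ler_wpM2l // ler_wpM2l // ler_wpM2l // ResK.
by rewrite le_eqVlt; apply/orP; left; apply/eqP; ring.
Qed.

(** Choosing the weights to be the phases of the individual pairings turns a
    single norm bound in [B(D)] into a bound on the sum of their moduli. *)
Lemma calculus_sum_le (x : X) (phi : X -> R[i]^o) : bounded_functional phi ->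
  exists2 C : R, 0 <= C &
    forall (r : R) N (om w0 : R[i]),
      N.-primitive_root om -> abs om = 1 -> abs w0 = r -> r < 1 ->
      r ^+ N <= 2^-1 ->
      \sum_(k < N) nrm (phi (T (Res (om ^+ k * w0) (Res (om ^+ k * w0) x))))
        <= C * N%:R / (1 - r).
Proof.
move=> phiB; have [c c0 phic] := bounded_linear_bound phiB.
have [M M0 PhiM] := calculus_bound hPhi.
exists (c * M * 12 * nrm x); first by rewrite !mulr_ge0 // nrm_ge0.
move=> r N om w0 omN om1 w0r r1 rN.
pose w (k : 'I_N) := om ^+ k * w0.
have w1 k : abs (w k) < 1 by rewrite absM absX om1 expr1n mul1r w0r.
pose F k : R[i] := phi (T (Res (w k) (Res (w k) x))).
pose a k := phase (F k).
pose g (z : R[i]^o) : R[i]^o := \sum_(k < N) a k * sq_kernel (w k) z.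
have sqC k : C1_bounded (sq_kernel (w k)).
  apply: C1_boundedM; first exact: C1_bounded_id.
  by apply: C1_boundedM; exact: C1_bounded_res_kernel.
have Phig : phi (Phi g x) = (\sum_(k < N) abs (F k))%:C.
  have [L LE] := linear_packed phiB.1.
  rewrite (calculus_sum hPhi) // LE linear_sum rmorph_sum /=.
  apply: eq_bigr => k _; rewrite linearZ /= -LE (calculus_sq_kernel hPhi) //.
  exact: phaseM.
have sum_abs : \sum_(k < N) abs (F k) = nrm (phi (Phi g x)).
  by rewrite Phig abs_real ger0_norm // sumr_ge0 // => k _; exact: nrm_ge0.
rewrite [leLHS]sum_abs; apply: le_trans (phic _) _.
have -> : c * M * 12 * nrm x * N%:R / (1 - r) =
    c * (M * (12 * N%:R / (1 - r)) * nrm x) by ring.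
rewrite ler_wpM2l //; apply: PhiM.
  by apply: C1_bounded_in_B; exact: C1_bounded_sum.
by apply: B_norm_sum_sq_kernel_le => // k; exact: abs_phase.
Qed.

Lemma calculus_dGSF : dGSF T.
Proof.
split; first exact: (calculus_spectral_radius hPhi).
move=> x phi phiB.
have [C C0 sum_le] := calculus_sum_le x phiB.
have [c c0 phic] := bounded_linear_bound phiB.
have pi0 := pi_gt0 R.
apply: (@le_lt_trans _ _ (2 * pi * (C + 1))%:E); last by rewrite ltry.
apply: ge_ereal_sup => _ [r r_itv <-].
have /andP[r0 r1] : 0 < r < 1 by move: r_itv; rewrite /= in_itv.
have r01 : 0 <= r < 1 by rewrite ltW.
have absp t : abs (polar r t) = r by rewrite abs_polar // ltW.
pose F t := T (Res (polar r t) (Res (polar r t) x)).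
have -> : (\int[lebesgue_measure]_(theta in `[(- pi)%R, pi%R])
    (nrm (phi (T (iter 2 (op_inv (one_minus T (polar r theta))) x))))%:E =
  \int[lebesgue_measure]_(theta in `[(- pi)%R, pi%R]) (nrm (phi (F theta)))%:E)%E.
  apply: eq_integral => t _.
  by rewrite (op_inv_one_minus hPhi) // absp.
have [L L0 FL] := calculus_sq_res_lipschitz x r01.
have phiF t s : nrm (phi (F t)) <= nrm (phi (F s)) + 2 * (c * L) * `|t - s|.
  have [P PE] := linear_packed phiB.1.
  have -> : phi (F t) = phi (F s) + phi (F t - F s).
    by rewrite PE linearB addrC subrK.
  apply: le_trans (le_nrmD _ _) _; rewrite lerD2l.
  have -> : 2 * (c * L) * `|t - s| = c * (L * (2 * `|t - s|)) by ring.
  apply: le_trans (phic _) _; rewrite ler_wpM2l //.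
  apply: le_trans (FL _ _ (absp _) (absp _)) _; rewrite ler_wpM2l //.
  by apply: lipschitz_polar; rewrite !ltW.
(* [r ^+ N <= 1/2] is for the bound on the sum over the nodes; the second
   condition makes the pairing vary by at most [1] over one arc. *)
have [N [rN LN]] := exists_fine_mesh (4 * pi * (c * L)) r01.
have N0 : (0 : R) < N.+1%:R by rewrite ltr0n.
pose delta : R := 2 * pi / N.+1%:R.
have delta0 : 0 <= delta by rewrite divr_ge0 ?mulr_ge0 // ltW.
have deltaN : N.+1%:R * delta = 2 * pi by rewrite mulrC divfK // gt_eqF.
have mesh : 2 * (c * L) * delta <= 1.
  have -> : 2 * (c * L) * delta = 4 * pi * (c * L) / N.+1%:R.
    by rewrite /delta; ring.
  by rewrite ler_pdivrMr // mul1r.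
pose b (k : 'I_N.+1) := nrm (phi (F (- pi + k%:R * delta))) + 1.
have int_le : (\int[lebesgue_measure]_(theta in `[(- pi)%R, pi%R])
    (nrm (phi (F theta)))%:E <= (delta * \sum_(k < N.+1) b k)%R%:E)%E.
  have piE : - pi + N.+1%:R * delta = pi by rewrite deltaN; lra.
  have riemann := @integral_le_riemann_sum R (fun t => nrm (phi (F t))) N
    (- pi) delta b delta0.
  rewrite piE in riemann; apply: riemann.
  - by move=> k; rewrite addr_ge0 // nrm_ge0.
  - by move=> t; exact: nrm_ge0.
  - move=> k t; rewrite -natr1 => tk.
    apply: le_trans (phiF t (- pi + k%:R * delta)) _; rewrite /b lerD2l; apply: le_trans mesh.
    rewrite ler_wpM2l ?mulr_ge0 //; rewrite ler_norml; lra.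
have nodes (k : 'I_N.+1) :
    polar r (- pi + k%:R * delta) = polar 1 delta ^+ k * polar r (- pi).
  rewrite polar1X polarE [polar r (- pi)]polarE polar1D mulr_natl.
  by rewrite [RHS]mulrC mulrA.
have sum_b : \sum_(k < N.+1) b k <= C * N.+1%:R / (1 - r) + N.+1%:R.
  rewrite big_split /= sumr_const card_ord lerD2r.
  rewrite (eq_bigr _ (fun k _ => congr1 (fun w => nrm (phi (T (Res w (Res w x)))))
    (nodes k))).
  by apply: sum_le => //; [exact: primitive_polar|exact: abs_polar].
apply: (@le_trans _ _ ((1 - r)%:E * (delta * \sum_(k < N.+1) b k)%:E)%E).
  by rewrite lee_wpmul2l // lee_fin; lra.
rewrite -EFinM lee_fin.
apply: (@le_trans _ _ ((1 - r) * (delta * (C * N.+1%:R / (1 - r) + N.+1%:R)))).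
  by rewrite ler_wpM2l ?ler_wpM2l //; lra.
have -> : (1 - r) * (delta * (C * N.+1%:R / (1 - r) + N.+1%:R)) =
    2 * pi * (C + (1 - r)).
  by rewrite -deltaN; field; rewrite subr_eq0 gt_eqF.
by rewrite ler_wpM2l ?mulr_ge0 ?(ltW pi0) // lerD2l; lra.
Qed.

End GomilkoShiFeng.

Theorem theorem3p5 (R : realType) (X : completeNormedModType R[i])
    (T : X -> X) (hT : bounded_linear T)
    (hcalc : admits_bounded_B_calculus T) :
  power_bounded T /\ dGSF T.
Proof.
have [Phi hPhi] := hcalc.
by split; [exact: calculus_power_bounded hPhi|exact: calculus_dGSF hPhi hT].
Qed.
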